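(* Let $p$ be an odd prime, let $\lambda\in\mathbb{Z}_p$ with $\lambda\neq 0$, let $q\in\mathbb{C}_p$ with $|1-q|_p<p^{-1/(p-1)}$, and let $x\in\mathbb{C}_p$. For every integer $m\ge 0$, $$\sum_{n=0}^m \widehat{Bl}_{n,q}(x|\lambda)\,q^{m-n}S_2(m,n)=\lambda^m E_m\left(1+\frac{x}{\lambda}\right)$$ and $$\widehat{Bl}_{m,q}(x|\lambda)=\sum_{\ell=0}^m S_1(m,\ell)\,q^{m-\ell}\lambda^\ell E_\ell\left(1+\frac{x}{\lambda}\right).$$
   Context: $\mathbb{Z}_p$ is the ring of $p$-adic integers and $\mathbb{C}_p$ is the completion of an algebraic closure of $\mathbb{Q}_p$, with norm normalized by $|p|_p=1/p$. For a continuous function $f$ on $\mathbb{Z}_p$ (with values in $\mathbb{C}_p$), the fermionic $p$-adic integral is $$\int_{\mathbb{Z}_p} f(y)\,d\mu_{-1}(y)=\lim_{N\to\infty}\sum_{y=0}^{p^N-1}f(y)(-1)^y.$$ The $q$-product is $(z)_{n,q}=z(z-q)(z-2q)\cdots(z-(n-1)q)$ for $n\ge 0$, with $(z)_{0,q}=1$, and $(z)_n=(z)_{n,1}$ is the falling factorial. The $q$-Boole polynomials of the second kind are $$\widehat{Bl}_{n,q}(x|\lambda)=\int_{\mathbb{Z}_p}(-\lambda y+x)_{n,q}\,d\mu_{-1}(y)\quad(n\ge 0).$$ The (signed) Stirling numbers of the first kind $S_1(n,\ell)$ and the Stirling numbers of the second kind $S_2(n,\ell)$ are defined by $(z)_n=\sum_{\ell=0}^n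 S_1(n,\ell)z^\ell$ and $z^n=\sum_{\ell=0}^n S_2(n,\ell)(z)_\ell$. The Euler polynomials $E_n(z)$ are defined by $\frac{2}{e^t+1}e^{zt}=\sum_{n=0}^\infty E_n(z)\frac{t^n}{n!}$. *)

(* Defs.v *)
From mathcomp Require Import all_boot all_order all_algebra.
From mathcomp Require Import all_classical all_reals all_analysis.

Set Implicit Arguments.
Unset Strict Implicit.
Unset Printing Implicit Defensive.

Import Order.TTheory GRing.Theory Num.Theory.
Import numFieldNormedType.Exports.
Local Open Scope classical_set_scope.
Local Open Scope ring_scope.

Definition nonarchimedean_abs (R : realType) (K : fieldType) (v : K -> R) :=
  [/\ forall x, 0 <= v x,
      forall x, v x = 0 <-> x = 0,
      {morph v : x y / x * y} &
      forall x y, v (x + y) <= Num.max (v x) (v y)].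

(* The library's normedZmodType requires `|x *+ n| = `|x| *+ n, which fails for
   p-adic norms, so p-adic convergence is expressed through the real sequence of
   distances. *)
Definition abs_cvg (R : realType) (K : fieldType) (v : K -> R)
    (u : nat -> K) (l : K) :=
  (fun n => v (u n - l)) @ \oo --> (0 : R).

Definition abs_cauchy (R : realType) (K : fieldType) (v : K -> R)
    (u : nat -> K) :=
  forall e : R, 0 < e ->
    exists N, forall m n, (N <= m)%N -> (N <= n)%N -> v (u m - u n) < e.

(* Equal to 0 when u diverges. *)
Definition abs_lim (R : realType) (K : fieldType) (v : K -> R)
    (u : nat -> K) : K :=
  xget 0 [set l | abs_cvg v u l].

Record completeValuedField (R : realType) := CompleteValuedField {
  cvf_field :> fieldType;
  absv : cvf_field -> R;
  absv_nonarchimedean : nonarchimedean_abs absv;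
  absv_complete : forall u, abs_cauchy absv u -> exists l, abs_cvg absv u l
}.

Definition is_completion (R : realType) (K : fieldType) (v : K -> R)
    (L : completeValuedField R) (i : {rmorphism K -> L}) :=
  (forall x, absv (i x) = v x) /\
  (forall (y : L) (e : R), 0 < e -> exists x, absv (y - i x) < e).

Definition is_algebraic_closure (K : fieldType) (L : closedFieldType)
    (i : {rmorphism K -> L}) :=
  forall x : L, algebraicOver i x.

Definition padic_abs (R : realType) (p : nat) (r : rat) : R :=
  if r == 0 then 0
  else p%:R ^+ logn p `|denq r|%N / p%:R ^+ logn p `|numq r|%N.

(* C_p with the tower Q -> Q_p -> algebraic closure of Q_p -> C_p by which it
   is defined.  The absolute value of C_p restricts to the p-adic one on Q, so
   |p| = 1/p. *)
Record padicComplex (R : realType) (p : nat) := PadicComplex {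
  Qp : completeValuedField R;
  rat_Qp : {rmorphism rat -> Qp};
  rat_Qp_completion : is_completion (padic_abs R p) rat_Qp;
  Qpbar : closedFieldType;
  Qp_Qpbar : {rmorphism Qp -> Qpbar};
  Qp_Qpbar_closure : is_algebraic_closure Qp_Qpbar;
  abs_Qpbar : Qpbar -> R;
  abs_Qpbar_nonarchimedean : nonarchimedean_abs abs_Qpbar;
  abs_Qp_Qpbar : forall a : Qp, abs_Qpbar (Qp_Qpbar a) = absv a;
  Cp :> completeValuedField R;
  Qpbar_Cp : {rmorphism Qpbar -> Cp};
  Qpbar_Cp_completion : is_completion abs_Qpbar Qpbar_Cp
}.

Section Boole.
Variables (R : realType) (p : nat) (C : padicComplex R p).

Definition Qp_Cp (a : Qp C) : C := Qpbar_Cp C (Qp_Qpbar C a).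

Definition padic_integer : set (Qp C) := [set a | absv a <= 1].

(* Only the values of f on Z_p matter, and naturals lie in Z_p. *)
Definition fermionic_integral (f : Qp C -> C) : C :=
  abs_lim (@absv R C) (fun N => \sum_(y < p ^ N) f y%:R * (-1) ^+ y).

End Boole.

Definition q_product (A : comNzRingType) (z q : A) (n : nat) : A :=
  \prod_(i < n) (z - i%:R * q).

Definition falling (A : comNzRingType) (z : A) (n : nat) : A :=
  q_product z 1 n.

Definition qBoole2 (R : realType) (p : nat) (C : padicComplex R p)
    (n : nat) (q x : C) (lambda : Qp C) : C :=
  fermionic_integral
    (fun y : Qp C => q_product (- Qp_Cp lambda * Qp_Cp y + x) q n).

Definition is_stirling1 (S1 : nat -> nat -> int) :=
  forall n, falling 'X n = \sum_(l < n.+1) S1 n l *: 'X^l :> {poly int}.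

Definition is_stirling2 (S2 : nat -> nat -> int) :=
  forall n, 'X^n = \sum_(l < n.+1) S2 n l *: falling 'X l :> {poly int}.

(* Formal power series in t, represented by their coefficient sequences. *)
Section FormalSeries.
Variable A : comUnitRingType.
Implicit Types a b : nat -> A.

Definition fps_mul a b (n : nat) : A := \sum_(i < n.+1) a i * b (n - i)%N.

Fixpoint fps_inv_seq a (n : nat) : seq A :=
  if n is m.+1 then
    let s := fps_inv_seq a m in
    rcons s ((a 0%N)^-1 * ((m == 0)%N%:R - \sum_(i < m) s`_i * a (m - i)%N))
  else [::].

Definition fps_inv a (n : nat) : A := (fps_inv_seq a n.+1)`_n.

Definition fps_exp (z : A) (n : nat) : A := n`!%:R^-1 * z ^+ n.

Lemma size_fps_inv_seq a n : size (fps_inv_seq a n) = n.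
Proof. by elim: n => //= n IHn; rewrite size_rcons IHn. Qed.

Lemma nth_fps_inv_seq a m n : (m < n)%N -> (fps_inv_seq a n)`_m = fps_inv a m.
Proof.
elim: n => // n IHn; rewrite ltnS leq_eqVlt => /predU1P[-> //|lt_mn].
by rewrite /= nth_rcons size_fps_inv_seq lt_mn IHn.
Qed.

Lemma fps_mulVr a : a 0%N \is a GRing.unit ->
  fps_mul (fps_inv a) a =1 fun n => (n == 0)%N%:R.
Proof.
move=> a0U n; rewrite /fps_mul big_ord_recr /= subnn {2}/fps_inv /=.
rewrite nth_rcons size_fps_inv_seq ltnn eqxx mulrC mulrA divrr // mul1r.
rewrite addrC -[RHS](subrK (\sum_(i < n) fps_inv a i * a (n - i)%N)).
congr (_ - _ + _); apply: eq_bigr => i _.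
by rewrite nth_fps_inv_seq.
Qed.

End FormalSeries.

(* E_n is n! times the coefficient of t^n in 2 / (e^t + 1) * e^(zt), a power
   series in t over K[z] with z = 'X. *)
Definition euler_poly (K : fieldType) (n : nat) : {poly K} :=
  n`!%:R * fps_mul
    (fun k => 2 * fps_inv (fun j => fps_exp 1 j + (j == 0)%N%:R) k)
    (fps_exp 'X) n.

(* Main.v *)
Require Import Defs.
From mathcomp Require Import all_boot all_order all_algebra.
From mathcomp Require Import all_classical all_reals all_analysis.
From mathcomp Require Import ring.

Import Order.TTheory GRing.Theory Num.Theory.
Import numFieldNormedType.Exports.
Local Open Scope ring_scope.

(** Everything rests on the functional equation E_m(z + 1) + E_m(z) = 2 z^m of
    the Euler polynomials ([euler_poly_shift]).  If f(y) = F(y) + F(y + 1) for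
    a polynomial F, then the alternating sum of f over 0 <= y < p^N telescopes
    to F(0) + F(p^N), because p^N is odd; as p^N tends to 0 and F is continuous,
    the fermionic integral of f is 2 F(0) ([has_fermionic_integral_shift]).

    With L the image of lambda and F(y) = L^m E_m(1 + x/L - y) / 2, the
    functional equation gives F(y) + F(y + 1) = (x - L y)^m, so the integral of
    (x - L y)^m is L^m E_m(1 + x/L) ([has_fermionic_integral_affineX]).

    The condition on q makes q nonzero.  The Stirling expansions, applied to
    z / q and multiplied by q^n, then express the q-products through powers and
    powers through q-products ([q_product_expand] and [q_product_exprn]).
    Integrating the first expansion term by term yields the formula for the
    q-Boole polynomials, and in particular the convergence of the integrals that
    define them.  Integrating the second one yields the other formula, since a
    fermionic integral has only one value. *)

(** * Formal power series and the Euler polynomials *)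

Section FormalSeries.
Variable A : comUnitRingType.
Implicit Types a b c : nat -> A.

(** Coefficients up to degree [m] only see truncations at degree [m], so that
    identities in the polynomial ring carry over to series. *)
Lemma fps_mulE a b n m : (n <= m)%N ->
  fps_mul a b n = ((\poly_(i < m.+1) a i) * (\poly_(i < m.+1) b i))`_n.
Proof.
move=> le_nm; rewrite coefM; apply: eq_bigr => i _; rewrite !coef_poly.
rewrite (leq_ltn_trans (leq_subr i n)) ?ltnS ?le_nm //.
by rewrite (leq_trans (leq_ord i) le_nm).
Qed.

Lemma fps_mulA a b c : fps_mul a (fps_mul b c) =1 fps_mul (fps_mul a b) c.
Proof.
move=> n.
have bcE : fps_mul a (fps_mul b c) n = ((\poly_(i < n.+1) a i) *
    ((\poly_(i < n.+1) b i) * (\poly_(i < n.+1) c i)))`_n.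
  rewrite coefM; apply: eq_bigr => i _.
  by rewrite -fps_mulE ?leq_subr // coef_poly ltn_ord.
rewrite bcE mulrA coefM; apply: eq_bigr => i _.
by rewrite -(fps_mulE _ _ _ _ (leq_ord i)) coef_poly ltnS leq_subr.
Qed.

Lemma fps_mul1l a : fps_mul (fun n => (n == 0)%N%:R) a =1 a.
Proof.
move=> n; rewrite /fps_mul big_ord_recl /= mul1r subn0 big1 ?addr0 // => i _.
by rewrite mul0r.
Qed.

Lemma eq_fps_mul a a' b b' :
  a =1 a' -> b =1 b' -> fps_mul a b =1 fps_mul a' b'.
Proof. by move=> eqa eqb n; apply: eq_bigr => i _; rewrite eqa eqb. Qed.

Lemma fps_inv_rec a n : fps_inv a n =
  (a 0%N)^-1 * ((n == 0)%N%:R - \sum_(i < n) fps_inv a i * a (n - i)%N).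
Proof.
rewrite {1}/fps_inv /= nth_rcons size_fps_inv_seq ltnn eqxx.
by congr (_ * (_ - _)); apply: eq_bigr => i _; rewrite nth_fps_inv_seq.
Qed.

Hypothesis factU : forall n, n`!%:R \is a @GRing.unit A.

Lemma fps_expD (z w : A) : fps_exp (z + w) =1 fps_mul (fps_exp z) (fps_exp w).
Proof.
move=> n; apply: (mulrI (factU n)); rewrite /fps_exp mulrA divrr // mul1r.
rewrite addrC exprDn mulr_sumr; apply: eq_bigr => i _.
have le_in := leq_ord i.
rewrite -mulr_natl -(bin_fact le_in) !natrM.
rewrite [RHS](_ : _ = 'C(n, i)%:R * (i`!%:R * i`!%:R^-1)
  * ((n - i)`!%:R * (n - i)`!%:R^-1) * (z ^+ i * w ^+ (n - i))); last by ring.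
by rewrite !divrr // !mulr1 [w ^+ _ * _]mulrC; congr (_ * _); rewrite mulrC.
Qed.

End FormalSeries.

(** For translations of the polynomial variable, this shows that the
    coefficients of 1 / (e^t + 1) are fixed. *)
Lemma rmorph_fps_inv (A B : comUnitRingType) (f : {rmorphism A -> B})
    (a : nat -> A) :
  a 0%N \is a GRing.unit -> forall n, f (fps_inv a n) = fps_inv (f \o a) n.
Proof.
move=> a0U; elim/ltn_ind => n IHn.
rewrite [in LHS]fps_inv_rec [in RHS]fps_inv_rec rmorphM rmorphV //= rmorphB.
rewrite rmorph_nat rmorph_sum.
by congr (_ * (_ - _)); apply: eq_bigr => i _; rewrite rmorphM IHn.
Qed.

Section Euler.
Variable K : fieldType.
Hypothesis charK : [pchar K] =i pred0.

Lemma natr_neq0 n : (0 < n)%N -> n%:R != 0 :> K.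
Proof. by move=> n0; rewrite (iffLR (pcharf0P _) charK) -lt0n. Qed.

Lemma poly_natrU n : (0 < n)%N -> n%:R \is a @GRing.unit {poly K}.
Proof.
move=> n0; rewrite -polyC_natr poly_unitE size_polyC coefC /= natr_neq0 //.
by rewrite unitfE natr_neq0.
Qed.

(** In terms of generating series,
    2 / (e^t + 1) * e^((X + 1) t) + 2 / (e^t + 1) * e^(X t) = 2 e^(X t).
    Translating X by 1 only affects the factor e^(X t), as the coefficients of
    2 / (e^t + 1) are constants. *)
Lemma euler_poly_shift n :
  euler_poly K n \Po ('X + 1) + euler_poly K n = 2 * 'X^n.
Proof.
pose a j : {poly K} := fps_exp 1 j + (j == 0)%N%:R.
have factU j := poly_natrU _ (fact_gt0 j).
have a0U : a 0%N \is a GRing.unit.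
  by rewrite /a /fps_exp fact0 invr1 mul1r expr0 -(natrD _ 1 1) poly_natrU.
pose f : {rmorphism {poly K} -> {poly K}} := comp_poly ('X + 1).
have fexp z j : f (fps_exp z j) = fps_exp (f z) j.
  by rewrite /f /fps_exp rmorphM rmorphV ?factU //= rmorph_nat rmorphXn.
have fa : f \o a = a.
  apply/funext => j; rewrite /a /= /f rmorphD /= -/f fexp.
  by rewrite /f rmorph_nat rmorph1.
have finv j : f (fps_inv a j) = fps_inv a j.
  by rewrite [LHS](rmorph_fps_inv _ _ f a a0U) -[in RHS]fa.
have expX1 k : fps_exp ('X + 1) k + fps_exp 'X k = fps_mul a (fps_exp 'X) k.
  rewrite ['X + 1]addrC (fps_expD _ factU).
  rewrite -[X in _ + X]fps_mul1l -big_split.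
  by apply: eq_bigr => i _ /=; rewrite -mulrDl.
transitivity (n`!%:R * (2 * fps_mul (fps_inv a) (fps_mul a (fps_exp 'X)) n)).
  rewrite -[_ \Po _]/(f _) /euler_poly -/a rmorphM rmorph_nat -mulrDr.
  congr (_ * _); rewrite rmorph_sum -big_split mulr_sumr.
  apply: eq_bigr => i _ /=.
  rewrite [f _]rmorphM [f (2 * _)]rmorphM rmorph_nat finv fexp.
  have -> : f 'X = 'X + 1 by exact: comp_polyX.
  by rewrite -expX1 -mulrDr mulrA.
rewrite fps_mulA (eq_fps_mul _ _ _ _ _ (fps_mulVr a0U) (fun=> erefl)) fps_mul1l.
by rewrite mulrCA /fps_exp mulVKr.
Qed.
End Euler.

(** * Nonarchimedean limits *)

Section Nonarchimedean.
Variables (R : realType) (K : fieldType) (v : K -> R).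
Hypothesis vP : nonarchimedean_abs v.

Lemma abs_ge0 x : 0 <= v x. Proof. by case: vP. Qed.
Lemma abs0 : v 0 = 0. Proof. by case: vP => _ /(_ 0) [_ ->]. Qed.
Lemma absM x y : v (x * y) = v x * v y. Proof. by case: vP. Qed.

Lemma abs1 : v 1 = 1.
Proof.
have v1_neq0 : v 1 != 0.
  by case: vP => _ /(_ 1) [v1 _] _ _; apply/eqP => /v1/eqP; rewrite oner_eq0.
by apply: (mulfI v1_neq0); rewrite -absM !mulr1.
Qed.

Lemma absX x n : v (x ^+ n) = v x ^+ n.
Proof. by elim: n => [|n IHn]; rewrite ?abs1 // !exprS absM IHn. Qed.

Lemma absN x : v (- x) = v x.
Proof.
suff vN1 : v (-1) = 1 by rewrite -mulN1r absM vN1 mul1r.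
apply/eqP; rewrite -sqrp_eq1 ?abs_ge0 //.
by rewrite -absX sqrrN expr1n abs1.
Qed.

Lemma absD_le x y : v (x + y) <= v x + v y.
Proof.
case: vP => _ _ _ /(_ x y) /le_trans; apply.
by rewrite ge_max lerDl lerDr !abs_ge0.
Qed.

Lemma abs_cvg_squeeze (u : nat -> K) l (e : nat -> R) :
  (forall n, v (u n - l) <= e n) -> (e @ \oo --> (0 : R))%classic ->
  abs_cvg v u l.
Proof.
move=> ule e0; apply: (@squeeze_cvgr _ _ _ _ (fun=> 0) e) => //; last first.
  exact: cvg_cst.
by near=> n; rewrite abs_ge0 ule.
Unshelve. all: by end_near. Qed.

Lemma abs_cvg_unique u l l' : abs_cvg v u l -> abs_cvg v u l' -> l = l'.
Proof.
move=> ul ul'; apply/eqP; rewrite -subr_eq0; apply/eqP.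
case: (vP) => _ /(_ (l - l')) [+ _] _ _; apply.
have ll' : abs_cvg v (fun=> l) l'.
  apply: (@abs_cvg_squeeze _ _ (fun n => v (u n - l) + v (u n - l'))).
    move=> n; have -> : l - l' = - (u n - l) + (u n - l') by ring.
    by rewrite (le_trans (absD_le _ _)) // absN.
  by rewrite -[0 : R]addr0; apply: cvgD.
by apply: (norm_cvg_unique _ ll'); apply: cvg_cst.
Qed.

Lemma abs_limE u l : abs_cvg v u l -> abs_lim v u = l.
Proof. by move=> ul; apply: xget_unique => // l' /abs_cvg_unique; apply. Qed.

Lemma abs_cvg0 : abs_cvg v (fun=> 0) 0.
Proof. by rewrite /abs_cvg subr0 abs0; apply: cvg_cst. Qed.

Lemma abs_cvgD u w k l :
  abs_cvg v u k -> abs_cvg v w l -> abs_cvg v (fun n => u n + w n) (k + l).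
Proof.
move=> uk wl.
apply: (@abs_cvg_squeeze _ _ (fun n => v (u n - k) + v (w n - l))).
  by move=> n; rewrite opprD addrACA absD_le.
by rewrite -[0 : R]addr0; apply: cvgD.
Qed.

Lemma abs_cvgZ c u l : abs_cvg v u l -> abs_cvg v (fun n => c * u n) (c * l).
Proof.
move=> ul; apply: (@abs_cvg_squeeze _ _ (fun n => v c * v (u n - l))).
  by move=> n; rewrite -mulrBr absM.
by rewrite -[0 : R](mulr0 (v c)); apply: cvgM => //; apply: cvg_cst.
Qed.

Lemma horner_bounded (F : {poly K}) :
  exists B, forall z, v z <= 1 -> v F.[z] <= B.
Proof.
elim/poly_ind: F => [|F c [B FB]]; first by exists 0 => z; rewrite horner0 abs0.
exists (B + v c) => z z1; rewrite hornerMXaddC (le_trans (absD_le _ _)) //.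
by rewrite lerD2r absM (le_trans (ler_piMr _ _)) ?FB ?abs_ge0.
Qed.

(** F(z) - F(0) is z times a polynomial in z, and the latter is bounded on the
    unit ball. *)
Lemma abs_cvg_horner (F : {poly K}) (z : nat -> K) :
  (forall n, v (z n) <= 1) -> abs_cvg v z 0 ->
  abs_cvg v (fun n => F.[z n]) F.[0].
Proof.
elim/poly_ind: F => [|F c _] z1 z0.
  by rewrite horner0; under eq_fun do rewrite horner0; exact: abs_cvg0.
have [B FB] := horner_bounded F.
apply: (@abs_cvg_squeeze _ _ (fun n => B * v (z n - 0))) => [n|].
  rewrite !hornerMXaddC mulr0 add0r addrK absM subr0.
  by rewrite ler_wpM2r ?abs_ge0 ?FB.
by rewrite -[0 : R](mulr0 B); apply: cvgM => //; apply: cvg_cst.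
Qed.

End Nonarchimedean.

(** * The fermionic integral *)

Lemma alternating_sum_telescope (A : comNzRingType) (F : nat -> A) n :
  \sum_(y < n) (F y + F y.+1) * (-1) ^+ y = F 0%N - (-1) ^+ n * F n.
Proof.
elim: n => [|n IHn]; first by rewrite big_ord0 expr0 mul1r subrr.
by rewrite big_ord_recr /= IHn exprS; ring.
Qed.

Section FermionicIntegral.
Variables (R : realType) (p : nat) (C : padicComplex R p).

(** The limit is a relation here because [fermionic_integral], being 0 on
    divergent sums, is linear only where the sums converge. *)
Definition has_fermionic_integral (f : Qp C -> C) (l : C) : Prop :=
  abs_cvg (@absv R C) (fun N => \sum_(y < p ^ N) f y%:R * (-1) ^+ y) l.

Let vP := absv_nonarchimedean C.

Lemma fermionic_integralE f l :
  has_fermionic_integral f l -> fermionic_integral f = l.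
Proof. exact: (abs_limE _ _ _ vP). Qed.

Lemma has_fermionic_integral_unique f l l' :
  has_fermionic_integral f l -> has_fermionic_integral f l' -> l = l'.
Proof. exact: (abs_cvg_unique _ _ _ vP). Qed.

Lemma has_fermionic_integral_sum n (c : 'I_n -> C) (f : 'I_n -> Qp C -> C) l :
  (forall i, has_fermionic_integral (f i) (l i)) ->
  has_fermionic_integral (fun y => \sum_(i < n) c i * f i y)
    (\sum_(i < n) c i * l i).
Proof.
elim: n c f l => [|n IHn] c f l fl.
  rewrite big_ord0 /has_fermionic_integral.
  under eq_fun do under eq_bigr do rewrite big_ord0 mul0r.
  under eq_fun do rewrite sumr_const mul0rn.
  exact: (abs_cvg0 _ _ _ vP).
rewrite big_ord_recr /has_fermionic_integral /=.
have := abs_cvgD _ _ _ vP _ _ _ _ (IHn (fun i => c (widen_ord (leqnSn n) i)) _ _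
  (fun i => fl (widen_ord (leqnSn n) i)))
  (abs_cvgZ _ _ _ vP (c ord_max) _ _ (fl ord_max)).
congr (abs_cvg _ _ _); apply/funext => N.
rewrite mulr_sumr -big_split; apply: eq_bigr => y _ /=.
by rewrite big_ord_recr /= mulrDl mulrA.
Qed.

Lemma Qp_Cp_nat n : Qp_Cp (n%:R : Qp C) = n%:R.
Proof. by rewrite /Qp_Cp !rmorph_nat. Qed.

Lemma absv_ratC (r : rat) :
  absv (Qp_Cp (rat_Qp C r)) = padic_abs R p r.
Proof.
rewrite /Qp_Cp (proj1 (Qpbar_Cp_completion C)) abs_Qp_Qpbar.
exact: (proj1 (rat_Qp_completion C)).
Qed.

Lemma absv_p : prime p -> absv (p%:R : C) = p%:R^-1.
Proof.
move=> p_pr; rewrite -Qp_Cp_nat -(rmorph_nat (rat_Qp C)) absv_ratC /padic_abs.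
rewrite pnatr_eq0 (gtn_eqF (prime_gt0 p_pr)).
rewrite (_ : p%:R = p%:Q) // denq_int numq_int /=.
by rewrite logn1 expr0 div1r logn_prime // eqxx expr1.
Qed.

Lemma pchar_Cp : [pchar C] =i pred0.
Proof.
move=> n; rewrite (fmorph_pchar (Qpbar_Cp C)) (fmorph_pchar (Qp_Qpbar C)).
by rewrite (fmorph_pchar (rat_Qp C)) pchar_num.
Qed.

(** The sums telescope to F(0) + F(p^N), and p^N tends to 0.  Oddness of p
    decides the sign of the second term. *)
Lemma has_fermionic_integral_shift (F : {poly C}) :
  prime p -> odd p ->
  has_fermionic_integral (fun y => F.[Qp_Cp y] + F.[Qp_Cp y + 1]) (2 * F.[0]).
Proof.
move=> p_pr p_odd; rewrite /has_fermionic_integral.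
have sumE N : \sum_(y < p ^ N) (F.[Qp_Cp y%:R] + F.[Qp_Cp y%:R + 1]) * (-1) ^+ y
    = F.[0] + F.[p%:R ^+ N].
  under eq_bigr do rewrite Qp_Cp_nat natr1.
  rewrite (alternating_sum_telescope _ (fun y => F.[y%:R])).
  by rewrite -signr_odd oddX p_odd orbT expr1 mulN1r opprK natrX.
under eq_fun do rewrite sumE.
rewrite mulr2n mulrDl !mul1r; apply: (abs_cvgD _ _ _ vP).
  by rewrite /abs_cvg subrr (abs0 _ _ _ vP); apply: cvg_cst.
have vp1 : p%:R^-1 < 1 :> R.
  by rewrite invf_lt1 ?ltr0n ?ltr1n ?prime_gt0 ?prime_gt1.
apply: (abs_cvg_horner _ _ _ vP) => [N|].
  by rewrite (absX _ _ _ vP) absv_p // exprn_ile1 ?invr_ge0 ?ler0n // ltW.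
rewrite /abs_cvg; under eq_fun do rewrite subr0 (absX _ _ _ vP) absv_p //.
by apply: cvg_expr; rewrite ger0_norm ?invr_ge0 ?ler0n.
Qed.

(** By [euler_poly_shift], L^m E_m(1 + x/L - y) / 2 is an antiderivative of
    the integrand for the operator that sends F(y) to F(y) + F(y + 1). *)
Lemma has_fermionic_integral_affineX (lambda : Qp C) (x : C) m :
  prime p -> odd p -> lambda != 0 ->
  has_fermionic_integral (fun y => (- Qp_Cp lambda * Qp_Cp y + x) ^+ m)
    (Qp_Cp lambda ^+ m * (euler_poly C m).[1 + x / Qp_Cp lambda]).
Proof.
move=> p_pr p_odd lambda0; set L := Qp_Cp lambda.
have L0 : L != 0 by rewrite !fmorph_eq0.
have two_neq0 : 2 != 0 :> C := natr_neq0 _ pchar_Cp 2 isT.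
move: (euler_poly C m) (euler_poly_shift _ pchar_Cp m) => E E_shift.
pose F := (L ^+ m / 2) *: (E \Po ((1 + x / L)%:P - 'X)).
have FE z : F.[z] = L ^+ m / 2 * E.[1 + x / L - z].
  by rewrite hornerZ horner_comp !hornerE.
have := has_fermionic_integral_shift F p_pr p_odd.
rewrite FE subr0 mulrA [2 * _]mulrC divfK //.
congr (has_fermionic_integral _ _); apply/funext => y; rewrite !FE.
have := congr1 (fun P => P.[x / L - Qp_Cp y]) E_shift.
rewrite hornerD horner_comp !hornerE => E_shift_y.
have -> : 1 + x / L - Qp_Cp y = x / L - Qp_Cp y + 1 by ring.
have -> : 1 + x / L - (Qp_Cp y + 1) = x / L - Qp_Cp y by ring.
rewrite -mulrDr E_shift_y mulrA divfK // -exprMn; congr (_ ^+ m).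
by field.
Qed.

End FermionicIntegral.

(** * Stirling expansions *)

Section Stirling.
Variables (K : fieldType) (q z : K).
Hypothesis q0 : q != 0.

(** The q-product is homogeneous of degree [n] in z and q, which reduces the
    Stirling expansions of q-products to those of falling factorials. *)
Lemma q_product_scale n : q_product z q n = q ^+ n * falling (z / q) n.
Proof.
rewrite /falling /q_product -[n in q ^+ n]card_ord -prodr_const -big_split.
apply: eq_bigr => i _ /=.
by rewrite mulrBr mulr1 [q * (z / q)]mulrC divfK // mulrC.
Qed.

Lemma horner_falling (w : K) n :
  (map_poly intr (falling ('X : {poly int}) n)).[w] = falling w n.
Proof.
rewrite rmorph_prod horner_prod; apply: eq_bigr => i _ /=.
rewrite rmorphB rmorphM rmorph_nat rmorph1 /= map_polyX !hornerE.
by rewrite -polyC_natr hornerC.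
Qed.

Lemma q_product_expand S1 n : is_stirling1 S1 ->
  q_product z q n = \sum_(l < n.+1) (S1 n l)%:~R * q ^+ (n - l) * z ^+ l.
Proof.
move=> S1P; rewrite q_product_scale -horner_falling S1P rmorph_sum horner_sum.
rewrite mulr_sumr; apply: eq_bigr => l _ /=.
rewrite map_polyZ map_polyXn !hornerE expr_div_n.
rewrite -{1}(subnK (leq_ord l)) exprD.
rewrite [LHS](_ : _ =
  q ^+ (n - l) * q ^+ l * (S1 n l)%:~R * (z ^+ l / q ^+ l)) //.
by field; rewrite expf_neq0.
Qed.

Lemma q_product_exprn S2 n : is_stirling2 S2 ->
  z ^+ n = \sum_(l < n.+1) q ^+ (n - l) * (S2 n l)%:~R * q_product z q l.
Proof.
move=> S2P; rewrite -{1}(divfK q0 z) exprMn -[(z / q) ^+ n]hornerXn.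
have <- : map_poly intr ('X^n : {poly int}) = 'X^n :> {poly K}.
  by rewrite map_polyXn.
rewrite S2P rmorph_sum horner_sum mulr_suml; apply: eq_bigr => l _ /=.
rewrite map_polyZ hornerZ horner_falling q_product_scale.
have -> : q ^+ n = q ^+ (n - l) * q ^+ l by rewrite -exprD subnK // leq_ord.
by ring.
Qed.

End Stirling.

Theorem theorem2p3 (R : realType) (p : nat) (p_prime : prime p)
    (p_odd : odd p) (C : padicComplex R p)
    (S1 S2 : nat -> nat -> int)
    (S1P : is_stirling1 S1) (S2P : is_stirling2 S2)
    (lambda : Qp C) (lambda_Zp : padic_integer lambda) (lambda_neq0 : lambda != 0)
    (q : C) (q_near1 : absv (1 - q) < p%:R `^ (- (p%:R - 1)^-1))
    (x : C) (m : nat) :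
  \sum_(n < m.+1) qBoole2 n q x lambda * q ^+ (m - n) * (S2 m n)%:~R
    = Qp_Cp lambda ^+ m * (euler_poly C m).[1 + x / Qp_Cp lambda]
  /\
  qBoole2 m q x lambda
    = \sum_(l < m.+1) (S1 m l)%:~R * q ^+ (m - l) * Qp_Cp lambda ^+ l
        * (euler_poly C l).[1 + x / Qp_Cp lambda].
Proof.
have vP := absv_nonarchimedean C.
(* If q were 0, then |1 - q| = 1, while p to a nonpositive power is at most 1. *)
have q_neq0 : q != 0.
  apply: contraTneq q_near1 => ->; rewrite subr0 (abs1 _ _ _ vP) -leNgt.
  rewrite -[leRHS](powRr0 p%:R) ler_powR ?ler1n ?prime_gt0 //.
  by rewrite oppr_le0 invr_ge0 subr_ge0 ler1n prime_gt0.
have powI :=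
  has_fermionic_integral_affineX _ _ C lambda x _ p_prime p_odd lambda_neq0.
pose B n := \sum_(l < n.+1) (S1 n l)%:~R * q ^+ (n - l) *
  (Qp_Cp lambda ^+ l * (euler_poly C l).[1 + x / Qp_Cp lambda]).
have prodI n : has_fermionic_integral _ _ C
    (fun y => q_product (- Qp_Cp lambda * Qp_Cp y + x) q n) (B n).
  rewrite (_ : (fun y => _) = fun y => \sum_(l < n.+1)
    (S1 n l)%:~R * q ^+ (n - l) * (- Qp_Cp lambda * Qp_Cp y + x) ^+ l).
    by apply: (has_fermionic_integral_sum _ _ _ _ _ (fun l y => _ ^+ l)) => l.
  by apply/funext => y; exact: q_product_expand.
have BE n : qBoole2 n q x lambda = B n by exact: fermionic_integralE.
split; last by rewrite BE; apply: eq_bigr => l _; rewrite !mulrA.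
apply: (has_fermionic_integral_unique _ _ _ _ _ _ _ (powI m)).
rewrite (_ : \sum_(n < _) _ =
  \sum_(n < m.+1) q ^+ (m - n) * (S2 m n)%:~R * B n); last first.
  by apply: eq_bigr => n _; rewrite BE -mulrA mulrC.
rewrite (_ : (fun y => _) = fun y => \sum_(n < m.+1) q ^+ (m - n) *
  (S2 m n)%:~R * q_product (- Qp_Cp lambda * Qp_Cp y + x) q n).
  by apply: (has_fermionic_integral_sum _ _ _ _ _
    (fun n y => q_product _ _ n)) => n.
by apply/funext => y; exact: q_product_exprn.
Qed.
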